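(* Let $m\ge 1$ be an integer and let $X$ be a finite $m$-almost quasigroup quandle. Suppose that for every $a\in X$ the stabilizer set $S_a=\{x\in X\mid a*x=a\}$ is a trivial subquandle of $X$ (i.e. $x*y=x$ for all $x,y\in S_a$). Then for every $n$, the torsion subgroup of the rack homology group $H_n^R(X)$ is annihilated by $m\cdot\operatorname{lcm}(|X|,|X|-m)$.
   Context: A quandle is a set $X$ with a binary operation $*$ such that: (1) $a*a=a$ for all $a$; (2) for each $b\in X$ the map $*_b:X\to X$, $x\mapsto x*b$, is a bijection; (3) $(a*b)*c=(a*c)*(b*c)$ for all $a,b,c$. The inverse of $*_b$ is written $x\mapsto x\,\overline{*}\,b$. A subquandle is a subset closed under $*$ and $\overline{*}$. A (sub)quandle is trivial if $x*y=x$ for all its elements $x,y$. For $a\in X$ put $S_a=\{x\in X\mid a*x=a\}$. The quandle $X$ is $m$-almost quasigroup if (i) for each $a\in X$ the set $S_a$ has exactly $m$ elements; and (ii) for each $a\in X$ and each $b\in X\setminus S_a$, the equation $a*x=b$ has a unique solution $x\in X$. Rack homology: $C_n^R(X)$ is the free abelian group on the set $X^n$ of $n$-tuples, and the boundary map $\partial_n:C_n^R(X)\to C_{n-1}^R(X)$ is $$\partial_n(x_1,\ldots,x_n)=\sum_{i=1}^n(-1)^i\big[(x_1,\ldots,x_{i-1},x_{i+1},\ldots,x_n)-(x_1*x_i,\ldots,x_{i-1}*x_i,x_{i+1},\ldots,x_n)\big].$$ $H_n^R(X)$ is the $n$th homology group of $(C_*^R(X),\partial_* )$ (integer coefficients).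 *)

(* Defs.v *)
From HB Require Import structures.
(* freeg comes first: its lift would otherwise shadow the lift of fintype. *)
From mathcomp Require Import freeg.
From mathcomp Require Import all_boot all_algebra zify.
From mathcomp Require Import boolp.

Set Implicit Arguments.
Unset Strict Implicit.
Unset Printing Implicit Defensive.

Import GRing.Theory.
Local Open Scope ring_scope.

HB.mixin Record isQuandle (X : Type) := {
  qop : X -> X -> X;
  qdiv : X -> X -> X;
  qopxx : forall a, qop a a = a;
  qopK : forall b, cancel (qop^~ b) (qdiv^~ b);
  qdivK : forall b, cancel (qdiv^~ b) (qop^~ b);
  qopD : forall a b c, qop (qop a b) c = qop (qop a c) (qop b c)
}.

#[short(type="quandleType")]
HB.structure Definition Quandle := { X of isQuandle X & Choice X }.

#[short(type="finQuandleType")]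
HB.structure Definition FinQuandle := { X of isQuandle X & Finite X }.

Declare Scope quandle_scope.
Delimit Scope quandle_scope with quandle.
Local Open Scope quandle_scope.
Notation "x *q y" := (qop x y) (at level 40, left associativity) : quandle_scope.
Notation "x /q y" := (qdiv x y) (at level 40, left associativity) : quandle_scope.

Section AlmostQuasigroup.
Variable X : finQuandleType.
Implicit Types (A : {set X}) (a b x y : X).

Definition subquandle A :=
  {in A &, forall x y, x *q y \in A} /\ {in A &, forall x y, x /q y \in A}.

Definition trivial_subquandle A :=
  subquandle A /\ {in A &, forall x y, x *q y = x}.

Definition stab a : {set X} := [set x | a *q x == a].

Definition almost_quasigroup (m : nat) :=
  (forall a, #|stab a| = m) /\
  (forall a b, b \notin stab a -> exists! x, a *q x = b).

End AlmostQuasigroup.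

Section RackHomology.
Variable X : quandleType.

Definition chain (n : nat) := {freeg (n.-tuple X)}.

Definition face n (i : 'I_n) (x : n.-tuple X) : n.-1.-tuple X :=
  [tuple tnth x (lift i j) | j < n.-1].

(* lift i j < i if and only if j < i. *)
Definition act_face n (i : 'I_n) (x : n.-tuple X) : n.-1.-tuple X :=
  [tuple if (j < i)%N then tnth x (lift i j) *q tnth x i
         else tnth x (lift i j) | j < n.-1].

(* Positions are numbered from 0, hence the exponent i.+1.  For n = 0 the sum
   is empty: the boundary of degree 0 is the zero map (to chain 0, as 0.-1 = 0,
   in place of the zero group in degree -1). *)
Definition boundary_gen n (x : n.-tuple X) : chain n.-1 :=
  \sum_(i < n) (-1) ^+ i.+1 *: (<< face i x >> - << act_face i x >>).

Definition boundary n : chain n -> chain n.-1 := fglift (@boundary_gen n).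

Lemma boundary_is_zmod_morphism n : zmod_morphism (@boundary n).
Proof. exact: lift_is_additive. Qed.

HB.instance Definition _ n :=
  GRing.isZmodMorphism.Build (chain n) (chain n.-1) (@boundary n)
    (@boundary_is_zmod_morphism n).

Let gface (e : bool) n := if e then @act_face n else @face n.

Let tnth_gface e n (i : 'I_n) (x : n.-tuple X) j :
  tnth (gface e i x) j = if e && (j < i)%N then tnth x (lift i j) *q tnth x i
                         else tnth x (lift i j).
Proof. by case: e; rewrite /= tnth_mktuple. Qed.

Let gface_comm e d n (i k : 'I_n.+1) (x : n.+2.-tuple X) : (i <= k)%N ->
  gface e k (gface d (widen_ord (leqnSn _) i) x) = gface d i (gface e (lift ord0 k) x).
Proof.
move=> ik; apply: eq_from_tnth => j; rewrite !tnth_gface !(@tnth_gface _ n.+2).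
set i' := widen_ord _ i; set k' := lift ord0 k.
have ei' : i' = i :> nat by []. have ek' : k' = k.+1 :> nat by [].
have -> : lift i' k = k' by apply/val_inj; rewrite /= /bump; lia.
have -> : lift k' i = i' by apply/val_inj; rewrite /= /bump; lia.
have -> : lift k' (lift i j) = lift i' (lift k j).
  by apply/val_inj; rewrite /= /bump; lia.
have -> : (lift k j < i')%N = (j < i)%N by rewrite /= /bump; lia.
have -> : (lift i j < k')%N = (j < k)%N by rewrite /= /bump; lia.
have -> : (k < i')%N = false by rewrite /=; lia.
have -> : (i < k')%N by rewrite ek'; lia.
rewrite !andbF !andbT; case: (ltnP j i) => ji; last by rewrite ?andbF.
have -> : (j < k)%N by lia.
case: e; case: d => /=; by [exact: qopD | reflexivity].
Qed.

Let DD n (x : n.+2.-tuple X) (i : 'I_n.+2) (k : 'I_n.+1) : chain n :=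
  << face k (face i x) >> - << act_face k (face i x) >>
  - (<< face k (act_face i x) >> - << act_face k (act_face i x) >>).

Let DDC n (x : n.+2.-tuple X) (i k : 'I_n.+1) : (i <= k)%N ->
  DD x (widen_ord (leqnSn _) i) k = DD x (lift ord0 k) i.
Proof.
move=> ik; rewrite /DD.
have H e d := gface_comm e d x ik.
move: (H false false) (H false true) (H true false) (H true true) => /= -> -> -> ->.
by rewrite !opprB addrACA [RHS]addrACA; congr (_ + _); exact: addrC.
Qed.

Lemma boundary_U n (x : n.-tuple X) : boundary << x >> = boundary_gen x.
Proof. by rewrite /boundary liftU scale1r. Qed.

Lemma boundaryZ n (c : int) (z : chain n) : boundary (c *: z) = c *: boundary z.
Proof. by rewrite -[c]intz !scaler_int raddfMz. Qed.

Lemma boundary_boundary n (z : chain n) : boundary (boundary z) = 0.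
Proof.
rewrite -[z]freeg_sumE !raddf_sum big1_seq // => x _.
have -> : << coeff x z *g x >> = coeff x z *: << x >> :> chain n.
  by apply/eqP/freeg_eqP => y; rewrite coeffZ !coeffU mul1r.
rewrite /= !boundaryZ; suff -> : boundary (boundary << x >>) = 0 :> chain _ by rewrite scaler0.
rewrite boundary_U; case: n {z} x => [|[|n]] x.
- by rewrite /boundary_gen big_ord0 raddf0.
- rewrite raddf_sum big1 // => i _.
  by rewrite /= boundaryZ raddfB /= !boundary_U /boundary_gen !big_ord0 subrr scaler0.
have -> : boundary (boundary_gen x) =
  \sum_(i < n.+2) \sum_(k < n.+1) (-1) ^+ (i + k) *: DD x i k.
  rewrite raddf_sum; apply: eq_bigr => i _.
  rewrite /= boundaryZ raddfB /= !boundary_U /boundary_gen -sumrB scaler_sumr.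
  apply: eq_bigr => k _; rewrite -scalerBr scalerA -exprD.
  by rewrite addnS addSn !exprS !mulN1r opprK.
have -> : \sum_(i < n.+2) \sum_(k < n.+1) (-1) ^+ (i + k) *: DD x i k =
  \sum_(i : 'I_n.+2) (\sum_(k : 'I_n.+1 | (i <= k)%N) (-1) ^+ (i + k) *: DD x i k
   + \sum_(k : 'I_n.+1 | (k < i)%N) (-1) ^+ (i + k) *: DD x i k).
  apply: eq_bigr => i _; rewrite (bigID (fun k : 'I_n.+1 => (i <= k)%N)) /=.
  by congr (_ + _); apply: eq_bigl => k; rewrite -ltnNge.
rewrite big_split /= big_ord_recr /= [X in _ + X + _]big1 ?addr0; last first.
  by move=> k; rewrite leqNgt ltn_ord.
rewrite [X in _ + X]big_ord_recl /= [X in _ + (X + _)]big_pred0 // add0r.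
rewrite [X in _ + X](exchange_big_dep predT) //= -big_split big1 //= => i _.
rewrite -[X in X + _](eq_bigr _ (fun k ik => congr1 _ (esym (DDC x ik)))).
rewrite -big_split big1 //= => k ik.
rewrite [bump 0 k]add1n addSn exprS [(k + i)%N]addnC mulN1r scaleNr.
exact: subrr.
Qed.

Definition cycles n : {pred chain n} := [pred z | boundary z == 0].

Lemma cycles_zmod_closed n : zmod_closed (@cycles n).
Proof.
split=> [|u v]; rewrite !inE ?raddf0 // => /eqP u0 /eqP v0.
by rewrite raddfB /= u0 v0 subrr.
Qed.

HB.instance Definition _ n :=
  GRing.isZmodClosed.Build (chain n) (@cycles n) (@cycles_zmod_closed n).

Record rack_cycle n := RackCycle { rack_cycle_val :> chain n; rack_cycleP : rack_cycle_val \in @cycles n }.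

HB.instance Definition _ n := [isSub for @rack_cycle_val n].
HB.instance Definition _ n := [Choice of rack_cycle n by <:].
HB.instance Definition _ n := [SubChoice_isSubZmodule of rack_cycle n by <:].

Definition boundaries n : {pred rack_cycle n} :=
  [pred z | `[< exists w : chain n.+1, boundary w = \val z >]].

Lemma boundaries_zmod_closed n : zmod_closed (@boundaries n).
Proof.
split=> [|u v]; rewrite !inE.
  by apply/asboolP; exists 0; rewrite !raddf0.
move=> /asboolP[w uE] /asboolP[w' vE]; apply/asboolP; exists (w - w').
by rewrite !raddfB /= uE vE.
Qed.

HB.instance Definition _ n :=
  GRing.isZmodClosed.Build (rack_cycle n) (@boundaries n) (@boundaries_zmod_closed n).

(* {ideal_quot _} is the quotient by any additive subgroup. *)
Definition rack_homology n : zmodType := {ideal_quot (@boundaries n)}.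

End RackHomology.

Definition torsion (V : zmodType) (v : V) := exists2 k, (0 < k)%N & v *+ k = 0.

(* Main.v *)
(* Write N = |X| and, on n-tuples with first position 0, let r_p replace the
   coordinates 0..p by copies of x_p, let q_p be the sum over u in S_{x_p}, and
   f_p the sum over all u in X, of the tuples whose coordinates 0..p are u.
   These are chain maps: the faces of a constant initial block cancel by
   idempotence.  Inserting after x_p,...,x_p a letter y, summed over X, is a
   homotopy; as x_p * y takes the value x_p exactly m times and every value
   outside S_{x_p} once, it gives (N - m) r_p ~ f_p - q_p.  The stabilizers being
   trivial, S_u = S_a for u in S_a, so precomposing with q_p gives
   N q_p ~ m f_p, and eliminating q_p yields N (N - m) r_p ~ (N - m) f_p.
   Precomposing with r_{p+1} fixes f_p and turns r_p into r_{p+1}; hence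
   N (N - m) id = N (N - m) r_0 ~ N (N - m) r_p for all p.  At the last
   position, f_p z is a multiple of deg z, which vanishes on torsion cycles.
   Finally gcd(N, N - m) divides m, so N (N - m) divides m lcm(N, N - m). *)
From HB Require Import structures.
(* freeg comes first: its lift would otherwise shadow the lift of fintype. *)
From mathcomp Require Import freeg.
From mathcomp Require Import all_boot all_algebra zify.
From mathcomp Require Import boolp.
Require Import Defs.

Set Implicit Arguments.
Unset Strict Implicit.
Unset Printing Implicit Defensive.

Import GRing.Theory Num.Theory.
Local Open Scope ring_scope.
Local Open Scope quotient_scope.
Local Open Scope quandle_scope.

(** * Additive maps on free abelian groups *)

(** Closure under differences yields opposites and sums, hence all integer multiples of
    generators. *)
Lemma freeg_ind (K : choiceType) (P : {freeg K} -> Prop) :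
  P 0 -> (forall x, P << x >>) -> (forall a b, P a -> P b -> P (a - b)) ->
  forall z, P z.
Proof.
move=> P0 PU PB z.
have PN a : P a -> P (- a) by move=> Pa; rewrite -sub0r; apply: PB.
have PD a b : P a -> P b -> P (a + b).
  by move=> Pa Pb; rewrite -[b]opprK; apply: PB => //; apply: PN.
have PMn a k : P a -> P (a *+ k).
  by move=> Pa; elim: k => [|k IHk]; rewrite ?mulr0n // mulrS; apply: PD.
rewrite -[z]freeg_sumE; elim/big_ind: _ => // x _.
have -> : << coeff x z *g x >> = << x >> *~ coeff x z :> {freeg K}.
  by rewrite freeg_mulz intz.
by case: (coeff x z) => k; rewrite ?NegzE ?mulrNz -pmulrn; [|apply: PN]; apply: PMn.
Qed.

Lemma freeg_additive_eq (K : choiceType) (V : zmodType) (f g : {freeg K} -> V) :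
  {morph f : a b / a - b} -> {morph g : a b / a - b} ->
  (forall x, f << x >> = g << x >>) -> f =1 g.
Proof.
move=> fB gB e; apply: freeg_ind => [||a b ea eb] //; last by rewrite fB gB ea eb.
by rewrite -(subrr 0) fB gB !subrr.
Qed.

Lemma subrACA (V : zmodType) : interchange (fun a b : V => a - b) (fun a b => a - b).
Proof. by move=> a b c d; rewrite !opprD !opprK addrACA. Qed.

(** This is the elimination of q_p: [a], [b], [c] stand for r_p z, f_p z, q_p z, and [k] for N -
    m. *)
Lemma mulrn_homotopy_elim (V : zmodType) (a b c : V) k m :
  c *+ k - (b *+ m - c *+ m) - (a *+ k - (b - c)) *+ (k + m)
  = b *+ k - a *+ (k * (k + m)).
Proof.
rewrite -mulrnBl; have [d ->] : exists d, b = d + c by exists (b - c); rewrite subrK.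
rewrite addrK mulrnBl -mulrnA opprB addrA mulrnDr mulrnDl; congr (_ - _).
by rewrite addrC addrACA subrr addr0.
Qed.

HB.instance Definition _ (K : choiceType) (M : lmodType int) (f : K -> M) :=
  GRing.isZmodMorphism.Build {freeg K} M (fglift f) (lift_is_additive f).

Lemma fgliftU (K : choiceType) (M : lmodType int) (f : K -> M) x :
  fglift f << x >> = f x.
Proof. by rewrite liftU scale1r. Qed.

(** * Replacement and insertion operators on tuples *)

Section Operators.
Variables (X : finQuandleType) (x0 : X).
Implicit Types (S : X -> {set X}) (u y : X) (p i : nat).

Lemma qop_inj y : injective (qop^~ y : X -> X).
Proof. exact: can_inj (qopK y). Qed.

Lemma eq_tuple n (x y : n.-tuple X) :
  (forall i, (i < n)%N -> nth x0 x i = nth x0 y i) -> x = y.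
Proof. by move=> e; apply: eq_from_tnth => i; rewrite !(tnth_nth x0) e. Qed.

Lemma nth_face n (i : 'I_n) (x : n.-tuple X) j :
  nth x0 (face i x) j = nth x0 x (bump i j).
Proof.
case: (ltnP j n.-1) => jn; last first.
  by rewrite !nth_default ?size_tuple // /bump; have := ltn_ord i; lia.
by rewrite -(tnth_nth x0 _ (Ordinal jn)) tnth_mktuple (tnth_nth x0).
Qed.

Lemma nth_act_face n (i : 'I_n) (x : n.-tuple X) j :
  nth x0 (act_face i x) j =
  if (j < i)%N then nth x0 x j *q nth x0 x i else nth x0 x (bump i j).
Proof.
have ltin := ltn_ord i; case: (ltnP j n.-1) => jn; last first.
  have -> : (j < i)%N = false by lia.
  by rewrite !nth_default ?size_tuple // /bump; lia.
rewrite -(tnth_nth x0 _ (Ordinal jn)) tnth_mktuple !(tnth_nth x0) /= /bump.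
by case: ltnP => // ji; rewrite leqNgt ji.
Qed.

Definition repl n p u (x : n.-tuple X) : n.-tuple X :=
  [tuple if (i <= p)%N then u else tnth x i | i < n].

Lemma nth_repl n p u (x : n.-tuple X) i : (i < n)%N ->
  nth x0 (repl p u x) i = if (i <= p)%N then u else nth x0 x i.
Proof.
by move=> ltin; rewrite -(tnth_nth x0 _ (Ordinal ltin)) tnth_mktuple (tnth_nth x0).
Qed.

(* At an out-of-range position [p] the coordinate x_p is read as [x0] in [ins],
   [spread] and [cone]; thus they may be applied at the last position of a tuple
   and also to its faces, where the two kinds of faces have equal images. *)
Definition ins n p y (x : n.-tuple X) : n.+1.-tuple X :=
  [tuple if (i <= p)%N then nth x0 x p else if i == p.+1 :> nat then y
         else nth x0 x i.-1 | i < n.+1].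

Lemma nth_ins n p y (x : n.-tuple X) i : (i < n.+1)%N ->
  nth x0 (ins p y x) i = if (i <= p)%N then nth x0 x p
                         else if i == p.+1 then y else nth x0 x i.-1.
Proof.
by move=> ltin; rewrite -(tnth_nth x0 _ (Ordinal ltin)) tnth_mktuple.
Qed.

Definition spread S n p : chain X n -> chain X n :=
  fglift (fun x : n.-tuple X => \sum_(u in S (nth x0 x p)) << repl p u x >>).

HB.instance Definition _ S n p := GRing.Additive.on (@spread S n p).

Lemma spreadU S n p (x : n.-tuple X) :
  spread S p << x >> = \sum_(u in S (nth x0 x p)) << repl p u x >>.
Proof. exact: fgliftU. Qed.

Definition cone n p : chain X n -> chain X n.+1 :=
  fglift (fun x : n.-tuple X => \sum_y << ins p y x >>).

HB.instance Definition _ n p := GRing.Additive.on (@cone n p).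

Lemma coneU n p (x : n.-tuple X) : cone p << x >> = \sum_y << ins p y x >>.
Proof. exact: fgliftU. Qed.

(** * Replacement operators as chain maps *)

Definition equivariant S := forall a b, S (a *q b) = [set u *q b | u in S a].

Lemma boundary_spreadU S n p (x : n.-tuple X) : equivariant S ->
  boundary (spread S p << x >>) = spread S p (boundary << x >>).
Proof.
move=> eqS; rewrite spreadU boundary_U !raddf_sum /=.
under eq_bigr do rewrite boundary_U.
rewrite exchange_big; apply: eq_bigr => i _ /=.
rewrite raddfZsign raddfB /= !spreadU -scaler_sumr sumrB; congr (_ *: _).
(* Inside the constant block the two faces of the replaced tuple agree by idempotence; the two faces
   of [x] agree from position [i] on, so replacing up to [p] makes them equal too. *)
case: (leqP i p) => ip.
  have -> : \sum_(u in S (nth x0 x p)) << act_face i (repl p u x) >> =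
            \sum_(u in S (nth x0 x p)) << face i (repl p u x) >> :> chain X n.-1.
    apply: eq_bigr => u _; congr << _ >>; apply: eq_tuple => j jn.
    rewrite nth_face nth_act_face; case: ltnP => // ji.
    have ltin := ltn_ord i.
    rewrite !nth_repl ?/bump; try lia.
    have -> : (j <= p)%N by lia.
    have -> : ((i <= j) + j <= p)%N by lia.
    by rewrite ip qopxx.
  rewrite subrr nth_face nth_act_face ltnNge ip /=.
  rewrite [X in _ - X](_ : _ =
    \sum_(u in S (nth x0 x (bump i p))) << repl p u (face i x) >>) ?subrr //.
  apply: eq_bigr => u _; congr << _ >>; apply: eq_tuple => j jn.
  rewrite !nth_repl // nth_face nth_act_face; case: ifP => // jp.
  by have -> : (j < i)%N = false by lia.
have ltin := ltn_ord i.
congr (_ - _).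
  rewrite nth_face /bump leqNgt ip add0n.
  apply: eq_bigr => u _; congr << _ >>; apply: eq_tuple => j jn.
  rewrite nth_face !nth_repl // ?nth_face /bump; try lia.
  by have -> : ((i <= j) + j <= p)%N = (j <= p)%N by lia.
(* Here x_i acts on the whole block, and equivariance reindexes the sum by u * x_i. *)
rewrite nth_act_face ip eqS (big_imset _ (in2W (@qop_inj _))) /=.
apply: eq_bigr => u _; congr << _ >>; apply: eq_tuple => j jn.
rewrite nth_repl // !nth_act_face /bump.
case: (ltnP j i) => ji; rewrite !nth_repl; try lia.
  by rewrite [(i <= p)%N]leqNgt ip; case: ifP.
by rewrite !ifF //; lia.
Qed.

Lemma boundary_spread S n p (z : chain X n) : equivariant S ->
  boundary (spread S p z) = spread S p (boundary z).
Proof.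
move=> eqS; elim/freeg_ind: z => [|x|a b ea eb].
- by rewrite [spread _ _ 0]raddf0 [boundary 0]raddf0 [RHS]raddf0.
- exact: boundary_spreadU.
by rewrite [spread _ _ (_ - _)]raddfB !(raddfB (@boundary _ _)) /= ea eb -raddfB.
Qed.

(** * The insertion homotopy *)

Lemma boundary_coneU n p (x : n.+1.-tuple X) : (p < n.+1)%N ->
  boundary (cone p << x >>) + cone p (boundary << x >>) =
  (-1) ^+ p *: (<< repl p (nth x0 x p) x >> *+ #|X| -
                \sum_y << repl p (nth x0 x p *q y) x >>).
Proof.
move=> ltpn; rewrite coneU boundary_U (raddf_sum (@boundary _ _)) (raddf_sum (@cone _ p)) /=.
under eq_bigr do rewrite boundary_U.
rewrite exchange_big /=.
have ltpn2 : (p.+1 < n.+2)%N by [].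
(* Removing the inserted letter, at position p + 1, gives the right-hand side; all other faces must
   cancel. *)
rewrite (bigD1_ord (Ordinal ltpn2)) //= -addrA -[RHS]addr0; congr (_ + _).
  rewrite -scaler_sumr sumrB !exprS !mulN1r opprK; congr (_ *: (_ - _)).
    rewrite -sumr_const; apply: eq_bigr => y _.
    congr << _ >>; apply: eq_tuple => j jn.
    rewrite nth_face nth_ins ?nth_repl // ?/bump; last lia.
    case: (leqP j p) => jp; first by rewrite ifT //; lia.
    by rewrite !ifF; try lia; congr nth; lia.
  apply: eq_bigr => y _; congr << _ >>; apply: eq_tuple => j jn.
  rewrite nth_act_face !nth_ins ?nth_repl // ?/bump /=; try lia.
  rewrite ltnn eqxx ltnS; case: leqP => jp //.
  by rewrite !ifF; try lia; congr nth; lia.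
rewrite -big_split big1 //= => k _; set k' := lift (Ordinal ltpn2) k.
rewrite raddfZsign raddfB /= !coneU -scaler_sumr sumrB.
have ltkn := ltn_ord k.
have ek' : k' = bump p.+1 k :> nat by [].
case: (leqP k p) => kp.
  have {}ek' : k' = k :> nat by rewrite ek' /bump; lia.
  rewrite [X in _ - X](_ : _ = \sum_y << face k' (ins p y x) >>); last first.
    apply: eq_bigr => y _; congr << _ >>; apply: eq_tuple => j jn.
    rewrite nth_face nth_act_face; case: ltnP => // jk.
    rewrite !nth_ins /bump; try lia.
    by rewrite !ifT ?qopxx //; lia.
  rewrite [X in _ + _ *: (_ - X)](_ : _ = \sum_y << ins p y (face k x) >>).
    by rewrite !subrr !scaler0 addr0.
  apply: eq_bigr => y _; congr << _ >>; apply: eq_tuple => j jn.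
  rewrite !nth_ins // !nth_face !nth_act_face.
  rewrite [(p < k)%N]ltnNge kp /=; case: ifP => // jp; case: ifP => // jp'.
  by rewrite ifF //; lia.
(* Past the block, the insertion shifts position k to k + 1, so matching faces carry opposite
   signs. *)
have {}ek' : k' = k.+1 :> nat by rewrite ek' /bump; lia.
rewrite -[bump p.+1 k]/(nat_of_ord k') ek' [in X in X + _]exprS mulN1r scaleNr addrC.
apply/eqP; rewrite subr_eq0; apply/eqP; congr (_ *: (_ - _)).
  apply: eq_bigr => y _; congr << _ >>; apply: eq_tuple => j jn.
  rewrite nth_face !nth_ins // ?nth_face ek' /bump; try lia.
  case: (leqP j p) => jp; first by rewrite ifT; [congr nth; lia | lia].
  rewrite [RHS]ifF; last lia.
  case: eqP => jp1; first by rewrite ifT //; lia.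
  by rewrite ifF; [congr nth; lia | lia].
(* The inserted letter is itself acted on by x_k, a bijection of the letters being summed. *)
rewrite [LHS](reindex_inj (@qop_inj (nth x0 x k))) /=.
apply: eq_bigr => y _; congr << _ >>; apply: eq_tuple => j jn.
rewrite nth_act_face ek' ltnS.
have insk : nth x0 (ins p y x) k.+1 = nth x0 x k.
  by rewrite nth_ins // !ifF //; lia.
case: (leqP j k) => jk.
  rewrite insk !nth_ins //; last lia.
  rewrite !nth_act_face kp; case: ifP => // jp; case: eqP => // jp1.
  by rewrite ifT //; lia.
rewrite !nth_ins /bump //; last lia.
rewrite !ifF; try lia.
rewrite nth_act_face ifF /bump; last lia.
by congr nth; lia.
Qed.

(* [qop a] collapses [stab a] to [a] and permutes its complement. *)
Lemma sum_qop m (V : zmodType) (F : X -> V) (a : X) : almost_quasigroup X m ->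
  \sum_y F (a *q y) = F a *+ m + (\sum_y F y - \sum_(y in stab a) F y).
Proof.
case=> card_stab solve.
rewrite (bigID (mem (stab a))) /= [\sum_y F y](bigID (mem (stab a))) /= addrAC subrr add0r.
congr (_ + _).
  rewrite -(card_stab a) -sumr_const; apply: eq_bigr => y.
  by rewrite inE => /eqP ->.
pose B := ~: stab a.
(* A solution y in [stab a] would force b = a, which lies in [stab a]. Once [B] is covered by its
   own image, finiteness gives equality and injectivity. *)
have sBfB : B \subset [set a *q y | y in B].
  apply/subsetP => b; rewrite inE => nSb; have [y [ayb _]] := solve a b nSb.
  apply/imsetP; exists y => //; rewrite !inE; apply: contra nSb => /eqP aya.
  by rewrite -ayb aya inE qopxx.
have /eqP fBE : B == [set a *q y | y in B] by rewrite eqEcard sBfB leq_imset_card.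
have finj : {in B &, injective (qop a)} by apply/imset_injP; rewrite -fBE.
have BE (G : X -> V) : \sum_(y | y \notin stab a) G y = \sum_(y in B) G y.
  by apply: eq_bigl => y; rewrite in_setC.
by rewrite !BE [in RHS]fBE (big_imset _ finj).
Qed.

Lemma spreadB S n p : {morph @spread S n p : z w / z - w}.
Proof. exact: raddfB. Qed.

Lemma coneB n p : {morph @cone n p : z w / z - w}.
Proof. exact: raddfB. Qed.

Lemma boundaryB n : {morph @boundary X n : z w / z - w}.
Proof. exact: raddfB. Qed.

Lemma boundary_cone m n p (z : chain X n.+1) :
  almost_quasigroup X m -> (p < n.+1)%N ->
  boundary (cone p z) + cone p (boundary z) =
  (-1) ^+ p *: (spread set1 p z *+ (#|X| - m)
                - (spread (fun=> setT) p z - spread (@stab X) p z)).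
Proof.
move=> aqX ltpn; move: z.
apply: freeg_additive_eq => [a b|a b|x].
- by rewrite !(coneB, boundaryB) addrACA -opprD.
- rewrite !spreadB mulrnBl -scalerBr; congr (_ *: _).
  by rewrite [RHS]subrACA; congr (_ - _); exact: subrACA.
rewrite boundary_coneU // (sum_qop (fun u => << repl p u x >>) _ aqX).
rewrite !spreadU big_set1 mulrnBr; last by rewrite -(aqX.1 x0) max_card.
rewrite opprD addrA; congr (_ *: (_ - (_ - _))).
by apply: eq_bigl => u; rewrite inE.
Qed.

(** * Compositions of the operators, and degree *)

Lemma spread_spread S S' k n p (z : chain X n) : (p < n)%N ->
  (forall a, #|S' a| = k) -> (forall a, {in S' a, forall v, S v = S a}) ->
  spread S p (spread S' p z) = spread S p z *+ k.
Proof.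
move=> ltpn card_S' SS'; move: z.
apply: freeg_additive_eq => [a b|a b|x]; rewrite ?spreadB ?mulrnBl //.
rewrite !spreadU raddf_sum /= -(card_S' (nth x0 x p)) -sumr_const.
(* The outer operator overwrites the block, and its range does not depend on [v]: each of the [k]
   terms gives the same sum. *)
apply: eq_bigr => v S'v; rewrite spreadU nth_repl // leqnn (SS' _ _ S'v).
apply: eq_bigr => u _; congr << _ >>; apply: eq_tuple => j jn.
by rewrite !nth_repl //; case: leqP.
Qed.

Lemma spread1_spread S n p (z : chain X n) : (p < n)%N ->
  spread set1 p (spread S p z) = spread S p z.
Proof.
move=> ltpn; move: z.
apply: freeg_additive_eq => [a b|a b|x]; rewrite ?spreadB //.
rewrite !spreadU raddf_sum; apply: eq_bigr => v _ /=.
rewrite spreadU nth_repl // leqnn big_set1; congr << _ >>.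
by apply: eq_tuple => j jn; rewrite !nth_repl //; case: leqP.
Qed.

Lemma spread1_spread1S n p (z : chain X n) : (p.+1 < n)%N ->
  spread set1 p (spread set1 p.+1 z) = spread set1 p.+1 z.
Proof.
move=> ltpn; move: z.
apply: freeg_additive_eq => [a b|a b|x]; rewrite ?spreadB //.
rewrite !(spreadU, big_set1); congr << _ >>; apply: eq_tuple => j jn.
by rewrite !nth_repl ?(ltnW ltpn) // leqnSn; case: (leqP j p) => // jp; rewrite ifT //; lia.
Qed.

Lemma spreadT_spread1S n p (z : chain X n) : (p.+1 < n)%N ->
  spread (fun=> setT) p (spread set1 p.+1 z) = spread (fun=> setT) p z.
Proof.
move=> ltpn; move: z.
apply: freeg_additive_eq => [a b|a b|x]; rewrite ?spreadB //.
rewrite !(spreadU, big_set1); apply: eq_bigr => u _; congr << _ >>.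
apply: eq_tuple => j jn; rewrite !nth_repl //; case: (leqP j p) => // jp.
by case: (leqP j p.+1) => // jp1; congr nth; lia.
Qed.

Lemma spread1_0 n (z : chain X n) : spread set1 0 z = z.
Proof.
move: z; apply: freeg_additive_eq => [a b|a b|x]; rewrite ?spreadB //.
rewrite spreadU big_set1; congr << _ >>; apply: eq_tuple => j jn.
by rewrite nth_repl //; case: j {jn}.
Qed.

Lemma spreadT_last n (z : chain X n.+1) :
  spread (fun=> setT) n z =
  (\sum_u << [tuple u | _ < n.+1] >>) *~ deg z.
Proof.
move: z; apply: freeg_additive_eq => [a b|a b|x]; rewrite ?spreadB ?degB ?mulrzBr //.
rewrite spreadU degU mulr1z; apply: eq_big => [u|u _]; first by rewrite inE.
congr << _ >>; apply: eq_tuple => j jn; rewrite nth_repl // -ltnS jn.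
by rewrite -(tnth_nth x0 _ (Ordinal jn)) tnth_mktuple.
Qed.

Lemma deg_boundary n (w : chain X n) : deg (boundary w) = 0.
Proof.
move: w; apply: freeg_additive_eq => [a b|a b|x]; rewrite ?boundaryB ?degB ?subrr //.
rewrite boundary_U raddf_sum big1 // => i _ /=.
by rewrite -signr_odd scaler_sign; case: ifP; rewrite ?degN degB !degU subrr.
Qed.

(** * Relations between cycles modulo boundaries *)

Definition is_boundary n (z : chain X n) := exists w : chain X n.+1, boundary w = z.

Lemma is_boundaryB n (z w : chain X n) :
  is_boundary z -> is_boundary w -> is_boundary (z - w).
Proof. by move=> [a <-] [b <-]; exists (a - b); rewrite boundaryB. Qed.

Lemma is_boundaryMn n (z : chain X n) k : is_boundary z -> is_boundary (z *+ k).
Proof. by move=> [a <-]; exists (a *+ k); rewrite raddfMn. Qed.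

Section Annihilation.
Variables (m n : nat).
Hypotheses (aqX : almost_quasigroup X m)
           (trivX : forall a : X, trivial_subquandle (stab a)).
Implicit Types z : chain X n.+1.
Local Notation M := (#|X| - m)%N.
Local Notation r := (spread set1).
Local Notation f := (spread (fun=> setT)).
Local Notation q := (spread (@stab X)).

Lemma equivariant_set1 : equivariant (@set1 X).
Proof. by move=> a b; rewrite imset_set1. Qed.

Lemma equivariant_stab : equivariant (@stab X).
Proof.
move=> a b; apply/setP => u; apply/idP/imsetP => [|[v]].
  rewrite inE => /eqP abu; exists (u /q b); last by rewrite qdivK.
  by rewrite inE; apply/eqP/(@qop_inj b); rewrite /= qopD qdivK.
by rewrite !inE => /eqP av ->; rewrite -qopD av.
Qed.

(** Triviality puts [stab a] inside [stab u], and both have m elements. *)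
Lemma stab_in (a : X) : {in stab a, forall u, stab u = stab a}.
Proof.
move=> u au; apply/esym/eqP; rewrite eqEcard !(aqX.1) leqnn andbT.
by apply/subsetP => v av; rewrite inE (trivX a).2.
Qed.

Lemma cone_homotopy p z : (p < n.+1)%N -> boundary z = 0 ->
  is_boundary (r p z *+ M - (f p z - q p z)).
Proof.
(* The sign cancels the one in [boundary_cone]. *)
move=> ltpn z0; exists ((-1) ^+ p *: cone p z).
rewrite boundaryZ -[boundary (cone p z)]addr0 -(raddf0 (@cone _ p)) -z0.
by rewrite (boundary_cone _ aqX ltpn) scalerA -expr2 sqrr_sign scale1r.
Qed.

(** The homotopy relation for the cycle q_p z, minus N times the relation for z, has no q_p term
    left. *)
Lemma spreadT_spread1 p z : (p < n.+1)%N -> boundary z = 0 ->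
  is_boundary (f p z *+ M - r p z *+ (M * #|X|)).
Proof.
move=> ltpn z0.
have leqmX : (m <= #|X|)%N by rewrite -(aqX.1 x0) max_card.
have qz0 : boundary (q p z) = 0.
  by rewrite (boundary_spread _ _ equivariant_stab) z0 raddf0.
have := cone_homotopy ltpn qz0.
rewrite spread1_spread // (spread_spread _ ltpn aqX.1 stab_in).
rewrite (spread_spread (S := fun=> setT) _ ltpn aqX.1) //.
move=> /is_boundaryB /(_ (is_boundaryMn #|X| (cone_homotopy ltpn z0))).
have := mulrn_homotopy_elim (r p z) (f p z) (q p z) M m.
by rewrite subnK // => ->.
Qed.

(** The relations at [p] for z and for r_{p+1} z share the same f_p term, which cancels in their
    difference. *)
Lemma spread1S p z : (p.+1 < n.+1)%N -> boundary z = 0 ->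
  is_boundary (r p.+1 z *+ (M * #|X|) - r p z *+ (M * #|X|)).
Proof.
move=> ltpn z0; have ltpn' := ltnW ltpn.
have rz0 : boundary (r p.+1 z) = 0.
  by rewrite (boundary_spread _ _ equivariant_set1) z0 raddf0.
have := spreadT_spread1 ltpn' rz0.
rewrite spread1_spread1S // spreadT_spread1S //.
move=> /(is_boundaryB (spreadT_spread1 ltpn' z0)).
by rewrite opprB addrC addrA subrK.
Qed.

Lemma spread1_homologous p z : (p < n.+1)%N -> boundary z = 0 ->
  is_boundary (z *+ (M * #|X|) - r p z *+ (M * #|X|)).
Proof.
move=> ltpn z0; elim: p ltpn => [|p IHp] ltpn.
  by rewrite spread1_0 subrr; exists 0; exact: raddf0.
have := is_boundaryB (IHp (ltnW ltpn)) (spread1S ltpn z0).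
by rewrite opprB addrA subrK.
Qed.

Lemma is_boundary_deg0 z : boundary z = 0 -> deg z = 0 ->
  is_boundary (z *+ (M * #|X|)).
Proof.
move=> z0 deg0; have := spreadT_spread1 (ltnSn n) z0.
rewrite spreadT_last deg0 mulr0z mul0rn sub0r.
move=> /(is_boundaryB (spread1_homologous (ltnSn n) z0)).
by rewrite opprK subrK.
Qed.

End Annihilation.
End Operators.

(** * From torsion cycles to homology classes *)

Lemma chain0E (X : finQuandleType) (z : chain X 0) :
  z = << [tuple] >> *~ deg z.
Proof.
move: z; apply: freeg_additive_eq => [a b|a b|x]; rewrite ?degB ?mulrzBr //.
by rewrite degU mulr1z tuple0.
Qed.

Lemma torsion_cycle_annihilated (X : finQuandleType) m n (z : chain X n) k :
  almost_quasigroup X m -> (forall a : X, trivial_subquandle (stab a)) ->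
  boundary z = 0 -> (0 < k)%N -> is_boundary (z *+ k) ->
  is_boundary (z *+ ((#|X| - m) * #|X|)).
Proof.
move=> aqX trivX z0 k_gt0 [w wz].
have deg0 : deg z = 0.
  have := deg_boundary w; rewrite wz degMn => /eqP.
  by rewrite mulrn_eq0 gtn_eqF // => /eqP.
(* Tuples of length 0 have no position to replace, but there degree 0 already means z = 0. *)
case: n => [|n] in z z0 w wz deg0 *.
  by rewrite (chain0E z) deg0 mulr0z mul0rn; exists 0; exact: raddf0.
case: (pickP (@predT X)) => [x0 _|X0]; first exact: is_boundary_deg0 z0 deg0.
by rewrite (eq_card0 X0) muln0 mulr0n; exists 0; exact: raddf0.
Qed.

Lemma homology_mulrn_eq0 (X : quandleType) n (z : rack_cycle X n) k :
  \pi_{ideal_quot (@boundaries X n)} z *+ k = 0 <->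
  exists w : chain X n.+1, boundary w = val z *+ k.
Proof.
rewrite -raddfMn -(raddf0 \pi_{ideal_quot (@boundaries X n)}) /=.
rewrite (rwP eqP) -Quotient.idealrBE subr0 inE -(rwP (asboolP _)).
by rewrite raddfMn.
Qed.

Theorem theorem3p2 (m : nat) (X : finQuandleType) :
  (0 < m)%N ->
  almost_quasigroup X m ->
  (forall a : X, trivial_subquandle (stab a)) ->
  forall (n : nat) (h : rack_homology X n),
    torsion h -> (h *+ (m * lcmn #|X| (#|X| - m)) = 0)%R.
Proof.
move=> m_gt0 aqX trivX n h [k k_gt0].
(* For empty [X] the multiplier is 0; otherwise a point [x0] shows m <= N, so N - m is a true
   difference. *)
case: (pickP (@predT X)) => [x0 _|X0]; last by rewrite (eq_card0 X0) lcm0n muln0.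
have leqmX : (m <= #|X|)%N by rewrite -(aqX.1 x0) max_card.
rewrite -[h]reprK; set z := repr h.
move=> /homology_mulrn_eq0 /(torsion_cycle_annihilated aqX trivX _ k_gt0) zB.
have /dvdnP[d ->] : ((#|X| - m) * #|X| %| m * lcmn #|X| (#|X| - m))%N.
  rewrite mulnC -muln_lcm_gcd mulnC dvdn_mul //.
  have := dvdn_sub (dvdn_gcdl #|X| (#|X| - m)) (dvdn_gcdr _ _).
  by rewrite subKn.
rewrite mulnC mulrnA [X in X *+ _](_ : _ = 0) ?mul0rn //.
by apply/homology_mulrn_eq0/zB/eqP/rack_cycleP.
Qed.
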